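(* Let $P_1=(p^1_1,p^1_2,\dots),\dots,P_n=(p^n_1,p^n_2,\dots)$ be properly arranged sequences and let $\sum_{\overline P}$ be the $n$-solenoid of the sequence of diagonal matrices $\overline P=\big(\mathrm{diag}(p^1_j,\dots,p^n_j)\big)_{j\ge1}$. (1) If $h$ is a topological automorphism of $\sum_{\overline P}$, $H:\mathbb R^n\to\mathbb R^n$ is the corresponding automorphism satisfying $h\circ\pi_{\overline P}=\pi_{\overline P}\circ H$, $A=(a_{ij})$ is the matrix representing $H$ and $A^{-1}=(b_{ij})$, then for all $i,j\in\{1,\dots,n\}$ the entries $a_{ij}$ and $b_{ij}$ are proper $P_j\to P_i$ multipliers. (2) If $A=(a_{ij})$ is an invertible $n\times n$ matrix with inverse $A^{-1}=(b_{ij})$ and, for all $i,j$, the entries $a_{ij}$ and $b_{ij}$ are proper $P_j\to P_i$ multipliers, then there is a topological automorphism $h$ of $\sum_{\overline P}$ represented by $A$, i.e. $h\circ\pi_{\overline P}=\pi_{\overline P}\circ A$. In other words, if $f$ denotes the map sending an automorphism $h$ of $\sum_{\overline P}$ to the (matrix of the) unique automorphism $H$ of $\mathbb R^n$ with $h\circ\pi_{\overline P}=\pi_{\overline P}\circ H$, then $$f\big(\mathrm{Aut}(\textstyle\sum_{\overline P})\big)=\{A\in GL(n,\mathbb Q): \text{for all } i,j \text{ the } (i,j)\text{ entries of } A \text{ and of } A^{-1}\text{ are proper } P_j\to P_i\text{ multipliers}\}.$$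
   Context: All homomorphisms and automorphisms of topological groups are continuous. $S^1=\mathbb R/\mathbb Z$, $\mathbf T^n=\prod_{i=1}^nS^1$, $p^n:\mathbb R^n\to\mathbf T^n$ is coordinatewise reduction mod $1$. $n$-solenoid: for a sequence $\overline M=(M_1,M_2,\dots)$ of $n\times n$ integer matrices with non-zero determinants, $\sum_{\overline M}=\{(\mathbf x^j)_{j\ge1}\in\prod_{j=1}^\infty\mathbf T^n:\mathbf x^j=f_j^{j+1}(\mathbf x^{j+1})\ \forall j\}$, where $f_j^{j+1}\circ p^n=p^n\circ M_j$; it is a topological group. $\pi_{\overline M}:\mathbb R^n\to\sum_{\overline M}$ is the homomorphism $\mathbf t\mapsto(p^n(\mathbf t),p^n(M_1^{-1}\mathbf t),\dots,p^n(M_j^{-1}\cdots M_1^{-1}\mathbf t),\dots)$. For every automorphism $h$ of $\sum_{\overline M}$ there is a unique homomorphism $H:\mathbb R^n\to\mathbb R^n$ with $h\circ\pi_{\overline M}=\pi_{\overline M}\circ H$, and $H$ is an automorphism. For a sequence of non-zero integers $P=(p_1,p_2,\dots)$, $\sum_P$ and $\pi_P:\mathbb R\to\sum_P$ denote the case $n=1$, $M_j=(p_j)$; $\mathbf C_P=\pi_P(\mathbb R)$ is the path component of the identity in $\sum_P$, with the subspace topology. Proper multipliers. For $r\in\mathbb R$ define a function $r^{P\to Q}:\mathbf C_P\to\mathbf C_Q$: if $P$ is not eventually $1$, $r^{P\to Q}(\pi_P(s))=\pi_Q(rs)$ for $s\in\mathbb R$; if $P$ is eventually $1$ and $p$ is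 the product of all its terms, then $\pi_P:[0,p)\to\mathbf C_P$ is a bijection and $r^{P\to Q}(\pi_P(s))=\pi_Q(rs)$ for $s\in[0,p)$. The number $r$ is a proper $P\to Q$ multiplier if $r^{P\to Q}$ is a (continuous) homomorphism of topological groups. Proper arrangement. The derived sequence $P'$ of a sequence $P=(p_1,p_2,\dots)$ of non-zero integers is the sequence of primes and $1$'s obtained by replacing successively each $|p_i|$ by its prime factors (with multiplicity) in order of magnitude, each term with $|p_i|=1$ being replaced by $1$. For a prime $q$, $card_q(P')$ is the number (possibly $\infty$) of occurrences of $q$ in $P'$. $P\le Q$ means: finitely many terms may be deleted from $P'$ so that each prime occurring in the resulting sequence occurs in $Q'$ with the same or greater cardinality. Let $f_0:\mathbb N\times\mathbb N\to\mathbb N$ be the bijection $f_0(k,i)=\frac{(k+i-2)(k+i-1)}2+i$ ($\mathbb N=\{1,2,\dots\}$). The proper arrangement of $P_1,\dots,P_n$ is the list of sequences $Q_1=(q^1_1,q^1_2,\dots),\dots,Q_n=(q^n_1,q^n_2,\dots)$ defined as follows, separately for each $k\in\mathbb N$, where $\ell_k$ is the $k$-th prime. Start with the full index set $J=\{1,\dots,n\}$. Let $\mu=\max\{card_{\ell_k}(P_j'):j\in J\}$ and $m=\min\{j\in J:card_{\ell_k}(P_j')=\mu\}$. Set $q^m_{f_0(k,i)}=\ell_k$ for $i\le\mu$ and $q^m_{f_0(k,i)}=1$ for $i>\mu$ (all equal to $\ell_k$ if $\mu=\infty$, all equal to $1$ if $\mu=0$). For every $j\in J$ with $P_m\le P_j$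 set $q^j_{f_0(k,i)}=q^m_{f_0(k,i)}$ for all $i$. Remove from $J$ all indices for which the terms have now been defined and repeat with the remaining $J$ until it is empty. $P_1,\dots,P_n$ are properly arranged if their proper arrangement is $P_1,\dots,P_n$ itself (so in particular all terms are primes or $1$). *)

(* Defs.v *)
From HB Require Import structures.
From mathcomp Require Import all_boot all_order all_algebra.
From mathcomp Require Import generic_quotient ring_quotient.
From mathcomp Require Import all_classical reals topology normedtype.
Set Implicit Arguments.
Unset Strict Implicit.
Unset Printing Implicit Defensive.
Import Order.TTheory GRing.Theory Num.Theory numFieldNormedType.Exports.
Local Open Scope classical_set_scope.
Local Open Scope card_scope.
Local Open Scope ring_scope.

(* Sequences are indexed from 0: entry [j] here is the entry numbered [j + 1]
   when sequences start at 1. *)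

HB.instance Definition _ (T : PreTopologicalZmodule.type) (m n : nat) :=
  Topological.on 'M[T]_(m, n).

Section TopologicalHomomorphisms.
Variables G H : PreTopologicalZmodule.type.

Definition top_hom (f : G -> H) : Prop := zmod_morphism f /\ continuous f.

Definition top_iso (f : G -> H) : Prop :=
  top_hom f /\ exists g : H -> G, [/\ cancel f g, cancel g f & continuous g].

End TopologicalHomomorphisms.

Section Torus.
Variable R : realType.

Definition integers : zmodClosed R :=
  GRing.ZmodClosed.clone R (@Num.int_num_subdef R) _.

Definition circle : Type := quotient_topology (Quotient.quot integers).
HB.instance Definition _ := Topological.on circle.
HB.instance Definition _ := GRing.Zmodule.copy circle (Quotient.quot integers).

Definition to_circle : R -> circle := \pi_(Quotient.quot integers)%qT.

Lemma to_circle_is_zmod_morphism : zmod_morphism to_circle.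
Proof. exact: raddfB. Qed.
HB.instance Definition _ :=
  GRing.isZmodMorphism.Build R circle to_circle to_circle_is_zmod_morphism.

Lemma to_circle_eq (s t : R) :
  (to_circle s = to_circle t) <-> s - t \is a Num.int.
Proof.
rewrite -[_ \is a _]/(s - t \in integers) Quotient.idealrBE.
by split=> [h|/eqP //]; apply/eqP.
Qed.

Local Notation torus n := 'cV[circle]_n.

Definition to_torus n (t : 'cV[R]_n) : torus n := map_mx to_circle t.

Definition torus_map n (M : 'M[int]_n) (x : torus n) : torus n :=
  \col_i \sum_(k < n) x k 0 *~ M i k.

Definition real_mx n (M : 'M[int]_n) : 'M[R]_n := map_mx intr M.

(* Since [to_torus] is onto, this identity determines [torus_map M]. *)
Lemma torus_map_to_torus n (M : 'M[int]_n) (t : 'cV[R]_n) :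
  torus_map M (to_torus t) = to_torus (real_mx M *m t).
Proof.
apply/matrixP => i j; rewrite !mxE raddf_sum; apply: eq_bigr => k _.
by rewrite !mxE mulrzl raddfMz ord1.
Qed.

Lemma torus_mapB n (M : 'M[int]_n) : zmod_morphism (torus_map M).
Proof.
move=> x y; apply/matrixP => i j; rewrite !mxE -sumrB.
by apply: eq_bigr => k _; rewrite !mxE mulrzBl.
Qed.

End Torus.

Record mxseq (n : nat) := MxSeq {
  mxseq_val :> nat -> 'M[int]_n;
  _ : forall j, \det (mxseq_val j) != 0
}.

Section Solenoid.
Variables (R : realType) (n : nat) (M : mxseq n).

Definition torus_seq : Type := {ptws nat -> 'cV[circle R]_n}.
HB.instance Definition _ := Topological.on torus_seq.
HB.instance Definition _ := GRing.isZmodule.Build torus_seq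
  (@addrA (nat -> 'cV[circle R]_n)) (@addrC (nat -> 'cV[circle R]_n))
  (@add0r (nat -> 'cV[circle R]_n)) (@addNr (nat -> 'cV[circle R]_n)).

Definition solenoid_pred (x : torus_seq) : bool :=
  `[< forall j, x j = torus_map (M j) (x j.+1) >].

Lemma solenoid_pred_zmod_closed : zmod_closed solenoid_pred.
Proof.
split=> [|x y /asboolP hx /asboolP hy]; apply/asboolP => j.
  apply/matrixP => i k; rewrite !mxE big1 // => l _.
  by rewrite mxE mul0rz.
transitivity (x j - y j); first by [].
by rewrite hx hy -torus_mapB.
Qed.
HB.instance Definition _ :=
  GRing.isZmodClosed.Build torus_seq solenoid_pred solenoid_pred_zmod_closed.

Definition solenoid : Type := {x : torus_seq | solenoid_pred x}.
HB.instance Definition _ := SubChoice.on solenoid.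
HB.instance Definition _ := [SubChoice_isSubZmodule of solenoid by <:].
HB.instance Definition _ := Topological.copy solenoid
  (initial_topology (val : solenoid -> torus_seq)).

(* [unwind t j] is (M_(j-1))^-1 ... (M_0)^-1 t. *)
Fixpoint unwind (t : 'cV[R]_n) (j : nat) : 'cV[R]_n :=
  if j is i.+1 then invmx (real_mx R (M i)) *m unwind t i else t.

Lemma real_mx_unit j : real_mx R (M j) \in unitmx.
Proof.
case: M => N hN /=; rewrite unitmxE /real_mx det_map_mx unitfE intr_eq0.
exact: hN.
Qed.

Lemma unwindB : {morph unwind : s t / s - t >-> s - t}.
Proof.
move=> s t; apply/funext; elim=> [//|j IH].
by rewrite [LHS]/= IH mulmxBr.
Qed.

Lemma unwind_solenoid t :
  solenoid_pred (fun j => to_torus (unwind t j)).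
Proof.
apply/asboolP => j /=.
by rewrite torus_map_to_torus mulmxA mulmxV ?mul1mx ?real_mx_unit.
Qed.

Definition solenoid_pi (t : 'cV[R]_n) : solenoid :=
  exist _ (fun j => to_torus (unwind t j)) (unwind_solenoid t).

Lemma solenoid_piB : zmod_morphism solenoid_pi.
Proof.
move=> s t; apply: val_inj; apply/funext => j /=.
by rewrite unwindB /to_torus raddfB.
Qed.
HB.instance Definition _ :=
  GRing.isZmodMorphism.Build 'cV[R]_n solenoid solenoid_pi solenoid_piB.

End Solenoid.

Section Lift.
Variables (R : realType) (n : nat) (M : mxseq n).
Local Notation Rn := 'cV[R]_n.
Local Notation pi := (@solenoid_pi R n M).

(* The lift of an automorphism [h] exists and is unique; the default value of
   [xget] has the zero matrix, which is singular for n > 0, so that it cannot be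
   mistaken for a lift. *)
Definition lift_of (h : solenoid R M -> solenoid R M) : Rn -> Rn :=
  xget (fun=> 0) [set H | top_iso H /\ h \o pi =1 pi \o H].

Definition matrix_of (H : Rn -> Rn) : 'M[R]_n :=
  \matrix_(i, j) H (delta_mx j 0) i 0.

End Lift.

Record nzseq := NzSeq {
  nzseq_val :> nat -> int;
  _ : forall j, nzseq_val j != 0
}.

Definition diag_seq n (P : 'I_n -> nzseq) (j : nat) : 'M[int]_n :=
  diag_mx (\row_i P i j).

Lemma diag_seq_det n (P : 'I_n -> nzseq) j : \det (diag_seq P j) != 0.
Proof.
rewrite det_diag; apply/prodf_neq0 => i _; rewrite mxE.
by case: (P i) => p; apply.
Qed.

Definition diag_mxseq n (P : 'I_n -> nzseq) : mxseq n :=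
  MxSeq (diag_seq_det P).

Section Multipliers.
Variable R : realType.

Definition seq_mxseq (P : nzseq) : mxseq 1 := diag_mxseq (fun=> P).

Definition seq_pi (P : nzseq) (s : R) : solenoid R (seq_mxseq P) :=
  solenoid_pi _ (const_mx s).

Lemma seq_piB P : zmod_morphism (seq_pi P).
Proof.
move=> s t; rewrite -solenoid_piB; congr solenoid_pi.
by apply/matrixP => i j; rewrite !mxE.
Qed.
HB.instance Definition _ P :=
  GRing.isZmodMorphism.Build R (solenoid R (seq_mxseq P)) (seq_pi P) (seq_piB P).

(* The path component of the identity is the range of [seq_pi P]. *)
Definition component_pred P (x : solenoid R (seq_mxseq P)) : bool :=
  `[< range (seq_pi P) x >].

Lemma component_pred_zmod_closed P : zmod_closed (@component_pred P).
Proof.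
split=> [|x y /asboolP[s _ <-] /asboolP[t _ <-]]; apply/asboolP.
  by exists 0 => //; rewrite raddf0.
by exists (s - t) => //; rewrite raddfB.
Qed.
HB.instance Definition _ P :=
  GRing.isZmodClosed.Build (solenoid R (seq_mxseq P)) (@component_pred P)
    (@component_pred_zmod_closed P).

Definition component P : Type :=
  {x : solenoid R (seq_mxseq P) | component_pred x}.
HB.instance Definition _ P := SubChoice.on (component P).
HB.instance Definition _ P := [SubChoice_isSubZmodule of component P by <:].
HB.instance Definition _ P := Topological.copy (component P)
  (initial_topology (val : component P -> solenoid R (seq_mxseq P))).

Lemma component_predT P s : component_pred (seq_pi P s).
Proof. by apply/asboolP; exists s. Qed.

Definition component_pi P (s : R) : component P :=
  exist _ (seq_pi P s) (component_predT P s).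

Definition eventually_one (P : nzseq) : Prop := \forall j \near \oo, P j = 1.

(* The finitely supported product is that of all the terms of [P].  When the
   terms of [P] are primes or 1, [component_pi P] is a bijection from this set
   onto the component of the identity. *)
Definition param_domain (P : nzseq) : set R :=
  if `[< eventually_one P >] then
    `[0, (\big[*%R/1]_(j \in [set: nat]) P j)%:~R[%classic
  else setT.

(* [component_pi P] maps [param_domain P] onto [component P], so that the equation
   determines [f], which is the map r^(P -> Q). *)
Definition proper_multiplier (P Q : nzseq) (r : R) : Prop :=
  exists2 f : component P -> component Q,
    (forall s, param_domain P s ->
       f (component_pi P s) = component_pi Q (r * s)) & top_hom f.

End Multipliers.

Definition prime_factors (m : nat) : seq nat :=
  if m == 1%N then [:: 1%N]
  else flatten [seq nseq (logn p m) p | p <- primes m].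

(* No block of prime factors is empty, so entry [k] of the concatenation of all
   the blocks already lies in the concatenation of the first [k.+1]. *)
Definition derived (P : nzseq) (k : nat) : nat :=
  nth 1%N (flatten [seq prime_factors `|P i|%N | i <- iota 0 k.+1]) k.

Definition occurrences (q : nat) (s : nat -> nat) : set nat :=
  [set k | s k = q].

(* [D] is the set of positions of the deleted terms.  A prime that does not occur
   after the deletion has an empty set of occurrences, and the inequality then
   holds trivially. *)
Definition nzseq_le (P Q : nzseq) : Prop :=
  exists2 D : set nat, finite_set D & forall q, prime q ->
    occurrences q (derived P) `\` D #<= occurrences q (derived Q).

Lemma ex_prime_above (m : nat) : exists p, (m < p)%N && prime p.
Proof. by have [p lt_mp pr_p] := prime_above m; exists p; apply/andP. Qed.

Definition next_prime (m : nat) : nat := ex_minn (ex_prime_above m).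

Definition nth_prime (k : nat) : nat := iter k next_prime 2.

Section ProperArrangement.
Variables (n : nat) (P : 'I_n -> nzseq) (k : nat).

Local Notation occ j := (occurrences (nth_prime k) (derived (P j))).

Definition maximal_in (J : {set 'I_n}) (m : 'I_n) : Prop :=
  m \in J /\ forall j, j \in J -> occ j #<= occ m.

Definition leader (J : {set 'I_n}) (m : 'I_n) : Prop :=
  maximal_in J m /\ forall j, maximal_in J j -> (m <= j)%N.

(* [arrange rounds J j i] is the term of the [j]-th sequence at the position paired
   with ([k], [i]), the indices in [J] being those still unsettled.  The number of
   occurrences mu of the prime for the leader may be infinite; as [i] starts at 0,
   the test "i <= mu" becomes [`I_i.+1 #<= occ m].  Each round settles at
   least the leader, so [n] rounds starting from all indices suffice and the
   default 1 is never reached. *)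
Fixpoint arrange (rounds : nat) (J : {set 'I_n}) (j : 'I_n) (i : nat) : nat :=
  if rounds is r.+1 then
    if [pick m | `[< leader J m >]] is Some m then
      let settled := [set l in J | (l == m) || `[< nzseq_le (P m) (P l) >]]%SET in
      if j \in settled then
        if `I_i.+1 #<= occ m then nth_prime k else 1
      else arrange r (J :\: settled)%SET j i
    else 1
  else 1.

End ProperArrangement.

(* The bijection (k, i) |-> (k + i - 2)(k + i - 1)/2 + i of the positive integers,
   with k, i and the value all shifted to start at 0. *)
Definition pairing (k i : nat) : nat := (((k + i) * (k + i).+1)./2 + i)%N.

Definition is_proper_arrangement n (P Q : 'I_n -> nzseq) : Prop :=
  forall (j : 'I_n) (k i : nat),
    Q j (pairing k i) = (arrange P k n [set: 'I_n]%SET j i)%:Z.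

Definition properly_arranged n (P : 'I_n -> nzseq) : Prop :=
  is_proper_arrangement P P.

Definition rational_GL (R : realType) (n : nat) : set 'M[R]_n :=
  [set map_mx ratr B | B in [set B : 'M[rat]_n | B \in unitmx]].

(* Main.v *)
Require Import Defs.
From HB Require Import structures.
From mathcomp Require Import all_boot all_order all_algebra.
From mathcomp Require Import all_classical reals topology normedtype.
From mathcomp Require Import ring lra zify.
Import Order.TTheory GRing.Theory Num.Theory numFieldNormedType.Exports.
Local Open Scope classical_set_scope.
Local Open Scope ring_scope.
Set Implicit Arguments.
Unset Strict Implicit.
Unset Printing Implicit Defensive.

(** The topology that a solenoid of [M] induces on the space of parameters
through [solenoid_pi] has the following neighbourhoods of the origin: the
vectors within a small distance of the lattice D_l Z^n, where
D_l = M_0 ... M_(l-1) is [winding M l].  A matrix [A] is therefore continuous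
from the topology of [M] to that of [N] if and only if for every [k] it carries
some lattice of [M] into the [k]-th lattice of [N], in other words if the matrix
D_k(N)^-1 A D_l(M) is integral for some [l].  This arithmetic condition is
[compatible].  It is necessary because a neighbourhood of the identity in a torus
contains no nontrivial subgroup, while every lattice point of [M] and all its
multiples are close to the origin ([compatible_of_near0]).  It is sufficient for
more than continuity: the integer matrices that it provides act on the levels of
the solenoid and define a homomorphism on the whole solenoid
([hom_of_compatible]), functorially in [A], so that inverse compatible matrices
give inverse automorphisms ([iso_of_compatible]).

Conversely an automorphism has a linear lift, since a continuous homomorphism
from the real line to the circle is multiplication by a real number
([continuous_character_linear], [linear_lift]); the lift is unique because the
parameter space is divisible and has no nontrivial homomorphism to the integers
([pi_hom_inj]).  So the automorphisms of the solenoid of [M] correspond to the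
invertible matrices [A] such that [A] and its inverse are both compatible.

For diagonal matrices the lattices are products of multiples of Z, and the
condition can be read entry by entry ([compatible_diagP]).  What it says about
the (i, j) entry is exactly that this entry is a proper multiplier: the
one-dimensional case of the same argument applies when [P j] is not eventually
1.  When [P j] is eventually 1, with product p of all its terms, the path
component is a circle of length p, and a map s |-> r s given for 0 <= s < p is additive
only if r p is a period of the target.  Here p > 0 because
the terms of a properly arranged sequence are primes or 1
([properly_arranged_gt0]).  Finally the condition at level 0, where the lattice
of the target is Z, forces the entries to be rational. *)

(** * The circle and its characters *)

Section Circle.
Variable R : realType.
Implicit Types (s t : R) (c d : circle R).

Lemma to_circle_surj c : exists s, c = to_circle s.
Proof. by exists (repr c); rewrite /to_circle reprK. Qed.

Lemma to_circle_eq0 s : to_circle s = 0 <-> s \is a Num.int.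
Proof. by rewrite -[0](raddf0 (@to_circle R)) to_circle_eq subr0. Qed.

Lemma to_circle_continuous : continuous (@to_circle R).
Proof. exact: pi_continuous. Qed.

(** The reduction map is open because the preimage of the image of an open set
is the union of its integer translates. *)
Lemma to_circle_nbhs s (V : set R) :
  nbhs s V -> nbhs (to_circle s) (@to_circle R @` V).
Proof.
move=> nV; rewrite nbhsE; exists (@to_circle R @` V°); last first.
  by move=> _ [v /interior_subset Vv <-]; exists v.
split; last by exists s.
rewrite -[open _]/(open (@to_circle R @^-1` (@to_circle R @` V°))).
rewrite openE => x /= [v Vv /to_circle_eq vx].
have : (y + (v - x)) @[y --> x] --> x + (v - x).
  by apply: cvgD; [exact: cvg_id|exact: cvg_cst].
rewrite [x + _]addrC subrK => /(_ _ (open_nbhs_nbhs (conj (open_interior _) Vv))) nx.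
suff sub : [set y | V° (y + (v - x))] `<=`
    @to_circle R @^-1` (@to_circle R @` V°) by exact: filterS sub nx.
move=> y /= Vy; exists (y + (v - x)) => //.
by apply/to_circle_eq; rewrite addrC addKr.
Qed.

Lemma circle_add_continuous :
  continuous (fun cd : circle R * circle R => cd.1 + cd.2).
Proof.
case=> c d; have [s ->] := to_circle_surj c; have [t ->] := to_circle_surj d.
move=> W /=; rewrite -raddfD => /to_circle_continuous nW.
have : (st.1 + st.2) @[st --> (s, t)] --> s + t.
  by apply: cvgD; [exact: cvg_fst|exact: cvg_snd].
move=> /(_ _ nW) [[V1 V2] /= [nV1 nV2] V12].
exists (@to_circle R @` V1, @to_circle R @` V2) => /=.
  by split; exact: to_circle_nbhs.
move=> [_ _] [/= [u Vu <-] [v Vv <-]]; rewrite -raddfD.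
exact: (V12 (u, v)).
Qed.

Lemma circle_mulz_continuous (z : int) : continuous (fun c => c *~ z : circle R).
Proof.
apply/quotient_continuous.
rewrite (_ : _ \o _ = @to_circle R \o (fun s => s * z%:~R)); last first.
  by apply/funext => s /=; rewrite mulrzr [RHS]raddfMz.
move=> s; apply: continuous_comp; last exact: to_circle_continuous.
by apply: cvgM; [exact: cvg_id|exact: cvg_cst].
Qed.

Definition small_arc (e : R) : set (circle R) :=
  @to_circle R @` [set s | `|s| < e].

Lemma small_arc_nbhs e : 0 < e -> nbhs (0 : circle R) (small_arc e).
Proof.
move=> e0; rewrite -(raddf0 (@to_circle R)); apply: to_circle_nbhs.
by apply/nbhs_ballP; exists e => //= s; rewrite /ball /= sub0r normrN.
Qed.

Lemma small_int_eq0 s : s \is a Num.int -> `|s| < 1 -> s = 0.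
Proof.
by move=> sZ; apply: contraTeq => /(norm_intr_ge1 sZ); rewrite leNgt.
Qed.

(** The representative of the double that lies in the arc differs from [s + s] by
an integer, and this integer is less than 1/2 + 1/4 in absolute value. *)
Lemma small_arc_double s :
  `|s| < 4^-1 -> small_arc 4^-1 (to_circle (s + s)) -> `|s + s| < 4^-1.
Proof.
move=> s4 [t /= t4 /to_circle_eq tsZ].
suff /eqP: t - (s + s) = 0 by rewrite subr_eq0 => /eqP <-.
apply: (small_int_eq0 tsZ); move: s4 t4; rewrite !ltr_norml; lra.
Qed.

(** If the multiples of [c] stay in the arc then the small representative of [c]
can be doubled for ever without leaving the interval of radius 1/4. *)
Lemma no_small_subgroup c : (forall m, small_arc 4^-1 (c *+ m)) -> c = 0.
Proof.
move=> cm; have [s s4 sc] := cm 1%N; rewrite /= mulr1n in s4 sc.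
have s_small k : `|s *+ 2 ^ k| < 4^-1.
  elim: k => [//|k IH].
  rewrite expnSr mulrnA mulr2n; apply: small_arc_double => //.
  by rewrite -mulr2n -mulrnA -expnSr (raddfMn (@to_circle R)) /= sc.
suff s0 : s = 0 by rewrite -sc s0 raddf0.
apply/eqP; apply: contraT => s_neq0; rewrite -normr_gt0 in s_neq0.
have := s_small (Num.Def.archi_bound (4^-1 / `|s|)).
rewrite normrMn -[`|s| *+ _]mulr_natr natrX ltNge => /negP[].
by rewrite -ler_pdivrMl // mulrC ltW // upper_nthrootP.
Qed.

(** Near 0 the values of [c] have small representatives, and halving the
argument halves the representative, as two small halves of a point of the circle
cannot differ by 1/2.  This determines the slope on a sequence of arguments
that tends to 0.  Removing the linear part leaves a homomorphism that vanishes on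
arbitrarily fine grids, hence with an image contained in a small arc; such an
image is trivial by [no_small_subgroup]. *)
Lemma continuous_character_linear (c : R -> circle R) :
  zmod_morphism c -> continuous c -> exists a, forall s, c s = to_circle (a * s).
Proof.
move=> cB c_cont.
pose c' : {additive R -> circle R} :=
  HB.pack c (GRing.isZmodMorphism.Build _ _ c cB).
have c0 : c 0 = 0 := raddf0 c'.
have cD x y : c (x + y) = c x + c y := raddfD c' x y.
have near0 e : 0 < e -> exists2 d, 0 < d & forall s, `|s| < d -> small_arc e (c s).
  move=> e0; have := c_cont 0; rewrite /continuous_at c0 => /(_ _ (small_arc_nbhs e0)).
  move=> /nbhs_ballP[d /= d0 dc]; exists d => // s sd.
  by apply: dc; rewrite /ball /= sub0r normrN.
have [d0 d0_gt0 d0P] : exists2 d, 0 < d & forall s, `|s| < d -> small_arc 8^-1 (c s).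
  by apply: near0; rewrite invr_gt0.
pose d := d0 / 2; have d_gt0 : 0 < d by rewrite divr_gt0.
pose dk k := d / 2 ^+ k.
have dkS k : dk k.+1 + dk k.+1 = dk k.
  by rewrite /dk exprS; field; rewrite expf_neq0 ?pnatr_eq0.
have dk_gt0 k : 0 < dk k by rewrite divr_gt0 ?exprn_gt0.
have dk_small k : `|dk k| < d0.
  rewrite gtr0_norm // /dk ltr_pdivrMr ?exprn_gt0 // /d ltr_pM2l //.
  apply: (@lt_le_trans _ _ 1); first by rewrite invf_lt1 ?ltr1n.
  exact/exprn_ege1/ler1n.
have [al al8 alE] := d0P _ (dk_small 0%N).
have c_dk k : c (dk k) = to_circle (al / d * dk k) /\ `|al / d * dk k| < 8^-1.
  elim: k => [|k [IH IH8]].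
    rewrite -alE /dk expr0 divr1 divfK ?gt_eqF //.
  have [be be8 beE] := d0P _ (dk_small k.+1).
  rewrite /= in be8 beE.
  have : to_circle (be + be) = to_circle (al / d * dk k).
    by rewrite -IH -dkS cD -beE raddfD.
  move=> /to_circle_eq beZ.
  have be0 : be + be - al / d * dk k = 0.
    apply: (small_int_eq0 beZ); move: IH8 be8; rewrite !ltr_norml; lra.
  have -> : al / d * dk k.+1 = be.
    have : al / d * (dk k.+1 + dk k.+1) = al / d * dk k by rewrite dkS.
    rewrite mulrDr; lra.
  by rewrite beE.
exists (al / d) => s.
pose g s := c s - to_circle (al / d * s).
have gB : zmod_morphism g.
  move=> x y; rewrite /g cB mulrBr raddfB !opprB addrACA [RHS]addrACA.
  by congr (_ + _); rewrite addrC.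
pose g' : {additive R -> circle R} :=
  HB.pack g (GRing.isZmodMorphism.Build _ _ g gB).
have gMz x z : g (x *~ z) = g x *~ z := raddfMz g' z x.
have gMn x m : g (x *+ m) = g x *+ m := raddfMn g' m x.
have g_dk k : g (dk k) = 0 by rewrite /g (c_dk k).1 subrr.
have g_small t : small_arc 4^-1 (g t).
  have e8 : (0 : R) < 8^-1 by rewrite invr_gt0.
  have [e e0 eP] := near0 _ e8.
  (* The grid is chosen so fine that on one of its cells [c] moves by less than
     1/8 and the linear map also moves by at most 1/8. *)
  pose C := 1 + 8 * `|al / d|.
  have C_ge1 : 1 <= C by rewrite lerDl mulr_ge0.
  have C_gt0 : 0 < C by exact: lt_le_trans C_ge1.
  set k := Num.Def.archi_bound (d / Num.min (e / C) C^-1).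
  have : dk k < Num.min (e / C) C^-1.
    have m0 : 0 < Num.min (e / C) C^-1 by rewrite lt_min divr_gt0 //= invr_gt0.
    rewrite /dk ltr_pdivrMr ?exprn_gt0 // mulrC -ltr_pdivrMr //.
    exact: upper_nthrootP.
  rewrite lt_min ltr_pdivlMr // => /andP[dk_e dk_C].
  pose z := Num.floor (t / dk k).
  have -> : g t = g (t - dk k *~ z).
    by rewrite gB gMz g_dk mul0rz subr0.
  set u := t - _.
  have [u_ge0 u_lt] : 0 <= u /\ u < dk k.
    have /andP[] := floor_itv (t / dk k); rewrite -/z ler_pdivlMr // ltr_pdivrMr //.
    by rewrite /u -mulrzl intrD mulrDl mul1r; lra.
  have [v v8 cv] : small_arc 8^-1 (c u).
    apply: eP; rewrite ger0_norm // (lt_le_trans u_lt) //.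
    by apply: ltW; apply: le_lt_trans dk_e; rewrite ler_peMr // ltW.
  rewrite /g -cv -raddfB; exists (v - al / d * u) => //=.
  have : `|al / d * u| <= 8^-1.
    rewrite normrM (ger0_norm u_ge0).
    have : `|al / d| * u <= `|al / d| * dk k by rewrite ler_wpM2l // ltW.
    have : dk k * C < 1 by rewrite -ltr_pdivlMr // div1r.
    by rewrite /C; have := dk_gt0 k; lra.
  by move: v8; rewrite /= !ler_norml !ltr_norml; lra.
suff gs0 : g s = 0 by exact: subr0_eq gs0.
by apply: no_small_subgroup => m; rewrite -gMn; exact: g_small.
Qed.

End Circle.

(** * The topology of a solenoid *)

Lemma mx_entry_continuous (U : topologicalType) m n (i : 'I_m) (j : 'I_n) :
  continuous (fun A : 'M[U]_(m, n) => A i j).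
Proof.
move=> A W nW; exists (fun i' j' => if (i' == i) && (j' == j) then W else setT).
  move=> i' j'; case: ifP => [/andP[/eqP -> /eqP ->] //|_].
  exact: filterT.
by move=> B /(_ i j); rewrite !eqxx.
Qed.

Lemma continuous_to_mx (T U : topologicalType) m n (f : T -> 'M[U]_(m, n)) :
  (forall i j, continuous (fun t => f t i j)) -> continuous f.
Proof.
move=> f_cont t W [V nV VW].
suff : \forall s \near t, forall i j, V i j (f s i j).
  by apply: filterS => s; exact: VW.
apply: filter_forall => i; apply: filter_forall => j.
exact: (f_cont i j t _ (nV i j)).
Qed.

Section Levels.
Variables (R : realType) (n : nat).

Lemma torus_map_continuous (B : 'M[int]_n) :
  continuous (torus_map B : 'cV[circle R]_n -> 'cV[circle R]_n).
Proof.
apply: continuous_to_mx => i j.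
rewrite (_ : (fun _ => _) =
    (fun x : 'cV[circle R]_n => \sum_(k < n) x k 0 *~ B i k)); last first.
  by apply/funext => x; rewrite mxE.
apply: (@continuous_big (circle R) 'I_n +%R 0 xpredT (@circle_add_continuous R)).
move=> k _ x; apply: (@continuous_comp 'cV[circle R]_n (circle R) (circle R)
  (fun x => x k 0) (fun c => c *~ B i k)).
  exact: mx_entry_continuous.
exact: circle_mulz_continuous.
Qed.

Variable M : mxseq n.
Local Notation Sol := (solenoid R M).

Lemma level_continuous k : continuous (fun x : Sol => val x k).
Proof.
move=> x; apply: (@continuous_comp Sol (torus_seq R n) 'cV[circle R]_n
  (fun x => val x) (fun y => y k)).
  exact: initial_continuous.
exact: (@proj_continuous nat (fun=> 'cV[circle R]_n) k).
Qed.

Lemma continuous_to_solenoid (T : topologicalType) (f : T -> Sol) :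
  (forall k, continuous (fun t => val (f t) k)) -> continuous f.
Proof.
move=> f_cont; apply: continuous_comp_initial => t.
apply/cvg_sup => k.
move: t; apply/(@continuousP _ (initial_topology (@^~ k))) => _ [B oB <-].
have /continuousP/(_ B oB) oF := f_cont k.
exact: oF.
Qed.

Lemma solenoid_level0 (x : Sol) k l :
  (k <= l)%N -> val x l = 0 -> val x k = 0.
Proof.
have /asboolP xP := valP x.
elim: l => [|l IH]; first by rewrite leqn0 => /eqP ->.
rewrite leq_eqVlt => /orP[/eqP -> //|kl] xl; apply: IH => //.
by rewrite xP xl; apply/matrixP => i j; rewrite !mxE big1 // => ? _; rewrite mxE mul0rz.
Qed.

(** The points whose coordinates vanish up to level [l] form a filter base that
converges to 0 in the product topology; in a solenoid the vanishing of level [l]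
implies that of the lower ones. *)
Lemma solenoid_nbhs0 (W : set Sol) :
  nbhs (0 : Sol) W -> exists l, forall x, val x l = 0 -> W x.
Proof.
move=> [_ [[U oU <-] U0] UW].
pose F : set_system (torus_seq R n) :=
  filter_from setT (fun l => [set y | forall k, (k <= l)%N -> y k = 0]).
have FF : Filter F.
  apply: filter_from_filter; first by exists 0%N.
  move=> i j _ _; exists (maxn i j) => // y yP.
  by split=> k kP; apply: yP; rewrite leq_max kP ?orbT.
have : F --> (0 : torus_seq R n).
  apply/cvg_sup => k A [_ [[B oB <-] B0] BA].
  exists k => // y /(_ _ (leqnn k)) yk; apply: BA => /=; rewrite yk.
  exact: B0.
move=> /(_ U (open_nbhs_nbhs (conj oU U0))) [l _ lU].
exists l => x xl; apply: UW; apply: lU => k kl.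
exact: solenoid_level0 xl.
Qed.

End Levels.

(** * Real matrices acting on the levels of a solenoid *)

Lemma invmxM (F : comUnitRingType) n (A B : 'M[F]_n) :
  A \in unitmx -> B \in unitmx -> invmx (A *m B) = invmx B *m invmx A.
Proof.
move=> uA uB; rewrite -[RHS](mulmxK (_ : A *m B \in unitmx)) ?unitmx_mul ?uA //.
by rewrite -(mulmxA (invmx B)) mulKmx // mulVmx // mul1mx.
Qed.

Section Winding.
Variables (R : realType) (n : nat).
Implicit Types M N : mxseq n.

Local Notation real := (@real_mx R n).

Lemma real_mxM B C : real (B *m C) = real B *m real C.
Proof. exact: map_mxM. Qed.

Lemma real_mx_inj : injective real.
Proof.
move=> B C /matrixP BC; apply/matrixP => i j.
by have := BC i j; rewrite !mxE => /intr_inj.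
Qed.

Lemma to_torus0P (t : 'cV[R]_n) :
  to_torus t = 0 <-> forall i, t i 0 \is a Num.int.
Proof.
split=> [t0 i|tZ].
  by apply/to_circle_eq0; have := congr1 (fun A : 'cV_n => A i 0) t0; rewrite !mxE.
by apply/matrixP => i j; rewrite ord1 !mxE; exact/to_circle_eq0.
Qed.

Lemma to_torusB (s t : 'cV[R]_n) : to_torus (s - t) = to_torus s - to_torus t.
Proof. exact: raddfB. Qed.

Lemma to_torus_surj (x : 'cV[circle R]_n) : exists t, x = to_torus t.
Proof.
have /choice[t tP] i := to_circle_surj (x i 0).
by exists (\col_i t i); apply/matrixP => i j; rewrite ord1 !mxE tP.
Qed.

Lemma torus_map_mul B C (x : 'cV[circle R]_n) :
  torus_map (B *m C) x = torus_map B (torus_map C x).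
Proof.
have [t ->] := to_torus_surj x.
by rewrite !torus_map_to_torus real_mxM mulmxA.
Qed.

Lemma torus_map1 (x : 'cV[circle R]_n) : torus_map 1%:M x = x.
Proof.
have [t ->] := to_torus_surj x.
by rewrite torus_map_to_torus /real_mx map_mx1 mul1mx.
Qed.

Fixpoint winding M (l : nat) : 'M[int]_n :=
  if l is k.+1 then winding M k *m M k else 1%:M.

Lemma winding_unit M l : real (winding M l) \in unitmx.
Proof.
elim: l => [|l IH] /=; first by rewrite /real_mx map_mx1 unitmx1.
by rewrite real_mxM unitmx_mul IH real_mx_unit.
Qed.

Lemma unwindE M (t : 'cV[R]_n) l :
  unwind M t l = invmx (real (winding M l)) *m t.
Proof.
elim: l => [|l IH] /=; first by rewrite /real_mx map_mx1 invmx1 mul1mx.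
by rewrite IH mulmxA real_mxM invmxM ?winding_unit ?real_mx_unit.
Qed.

(** The columns of [winding M l] span the lattice of parameters whose image
vanishes at level [l] of the solenoid of [M]; the condition says that [A] carries
one of these lattices into the given lattice of [N]. *)
Definition compatible M N (A : 'M[R]_n) := forall k, exists l (B : 'M[int]_n),
  A *m real (winding M l) = real (winding N k) *m real B.

Lemma solenoid_level M l l' : (l <= l')%N -> exists2 C,
  winding M l' = winding M l *m C &
  forall x : solenoid R M, val x l = torus_map C (val x l').
Proof.
move=> /subnKC <-; elim: (l' - l)%N => [|d [C CE CP]].
  by exists 1%:M => [|x]; rewrite addn0 ?mulmx1 ?torus_map1.
exists (C *m M (l + d)%N) => [|x]; first by rewrite addnS /= CE mulmxA.
by rewrite torus_map_mul CP addnS; have /asboolP <- := valP x.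
Qed.

(** On the image of [solenoid_pi] both sides are the reduction of the same linear
map of the parameter.  In general, writing the lower level as an integral image
of the higher one reduces the claim to an identity between integer matrices. *)
Lemma levels_agree M (x : solenoid R M) B B' l l' :
  real B *m invmx (real (winding M l)) = real B' *m invmx (real (winding M l')) ->
  torus_map B (val x l) = torus_map B' (val x l').
Proof.
wlog ll' : B B' l l' / (l <= l')%N => [hw BB'|BB'].
  have [ll'|/ltnW l'l] := leqP l l'; first exact: hw.
  by apply/esym/hw.
have [C CE ->] := solenoid_level M ll'.
rewrite -torus_map_mul; congr torus_map; apply: real_mx_inj.
rewrite -[RHS](mulmxKV (winding_unit M l')) -BB' CE !real_mxM.
by rewrite mulmxA mulmxKV ?winding_unit.
Qed.

(** If [t] is in the [l]-th lattice then so are its multiples, and the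
neighbourhood [W] contains the images of all of them.  Their images at level [k]
of the solenoid of [N] form a subgroup contained in a small arc in each
coordinate, and so they vanish. *)
Lemma compatible_of_near0 M N A :
  (forall k, exists2 W, nbhs (0 : solenoid R M) W &
    forall t, W (solenoid_pi M t) ->
      forall i, small_arc 4^-1 (val (solenoid_pi N (A *m t)) k i 0)) ->
  compatible M N A.
Proof.
move=> near0 k; have [W /solenoid_nbhs0[l lW] WA] := near0 k.
(* The columns of E are the images of a basis of the [l]-th lattice of [M], in
   coordinates with respect to the [k]-th lattice of [N]. *)
exists l; pose E := invmx (real (winding N k)) *m (A *m real (winding M l)).
have EZ i j : E i j \is a Num.int.
  apply/to_circle_eq0/no_small_subgroup => m.
  pose t : 'cV[R]_n := real (winding M l) *m (delta_mx j 0 *+ m).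
  have : W (solenoid_pi M t).
    apply: lW; rewrite /= unwindE mulKmx ?winding_unit //.
    apply/to_torus0P => i'; rewrite mulmxnE mxE.
    by rewrite rpredMn // intr_nat.
  move=> /WA/(_ i); rewrite /= mxE unwindE /t !mulmxA.
  rewrite -(mulmxA (invmx _)) -/E (raddfMn (mulmx E)) mulmxnE raddfMn.
  suff -> : (E *m (delta_mx j 0 : 'cV_n)) i 0 = E i j by [].
  by rewrite -colE mxE.
exists (\matrix_(i, j) Num.floor (E i j)).
rewrite -[LHS](mulKVmx (winding_unit N k)) -/E; congr (_ *m _).
apply/matrixP => i j; rewrite [RHS]mxE [X in X%:~R]mxE.
exact/esym/floorK.
Qed.

(** The homomorphism induced by [A] must read level [k] of its value off any
level [l] of the argument for which [A] carries the [l]-th lattice of [M] into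
the [k]-th lattice of [N]; asking for all such [l] at once makes compositions
easy to compute. *)
Definition level_action M N A (h : solenoid R M -> solenoid R N) :=
  forall k l B, A *m real (winding M l) = real (winding N k) *m real B ->
    forall x, val (h x) k = torus_map B (val x l).

(** All admissible choices of a level and of an integer matrix give the same
value by [levels_agree].  Hence the values at consecutive levels fit together,
and each of them depends continuously on a single level of the argument. *)
Lemma hom_of_compatible M N A : compatible M N A ->
  exists2 h : solenoid R M -> solenoid R N, top_hom h & level_action A h.
Proof.
move=> /choice[l /choice[B AB]].
have AB' k : real (B k) *m invmx (real (winding M (l k))) =
    invmx (real (winding N k)) *m A.
  by rewrite -[A in RHS](mulmxK (winding_unit M (l k))) AB !mulmxA mulVmx
    ?mul1mx ?winding_unit.
pose h x : torus_seq R n := fun k => torus_map (B k) (val (x : solenoid R M) (l k)).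
have h_in x : solenoid_pred N (h x).
  apply/asboolP => k; rewrite /h -torus_map_mul; apply: levels_agree.
  rewrite real_mxM -mulmxA !AB' /= real_mxM invmxM ?winding_unit ?real_mx_unit //.
  by rewrite !mulmxA mulmxV ?mul1mx ?real_mx_unit.
exists (fun x => exist _ (h x) (h_in x)).
  split.
    move=> x y; apply: val_inj; apply/funext => k /=.
    exact: torus_mapB.
  apply: continuous_to_solenoid => k x.
  apply: (@continuous_comp (solenoid R M) 'cV[circle R]_n 'cV[circle R]_n
    (fun x => val x (l k)) (torus_map (B k))).
    exact: level_continuous.
  exact: torus_map_continuous.
move=> k l' B' E x; apply: levels_agree; rewrite AB'.
by rewrite -[A](mulmxK (winding_unit M l')) E !mulmxA mulVmx ?mul1mx ?winding_unit.
Qed.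

Lemma hom_levels_pi M N A (h : solenoid R M -> solenoid R N) :
  compatible M N A -> level_action A h ->
  forall t, h (solenoid_pi M t) = solenoid_pi N (A *m t).
Proof.
move=> cA hP t; apply: val_inj; apply/funext => k /=.
have [l [B AB]] := cA k; rewrite (hP _ _ _ AB) torus_map_to_torus !unwindE.
rewrite -[A](mulmxK (winding_unit M l)) AB !mulmxA mulVmx ?winding_unit //.
by rewrite mul1mx.
Qed.

End Winding.

(** * Linear lifts of homomorphisms *)

Section Lifting.
Variables (R : realType) (n : nat).
Implicit Types M N : mxseq n.
Local Notation real := (@real_mx R n).

Lemma mulmx_continuous (A : 'M[R]_n) :
  continuous (fun t : 'cV[R]_n => A *m t).
Proof.
apply: continuous_to_mx => i j.
rewrite (_ : (fun _ => _) = (fun t : 'cV[R]_n => \sum_k A i k * t k j)); last first.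
  by apply/funext => t; rewrite mxE.
apply: (@continuous_big R 'I_n +%R 0 xpredT).
  exact: (@add_continuous R^o).
move=> k _ x; apply: (@continuous_comp 'cV[R]_n R R
  (fun t => t k j) (fun s => A i k * s)); first exact: mx_entry_continuous.
by apply: cvgM; [exact: cvg_cst|exact: cvg_id].
Qed.

Lemma mulmx_top_iso (A : 'M[R]_n) : A \in unitmx ->
  top_iso (fun t : 'cV[R]_n => A *m t).
Proof.
move=> uA; split; last first.
  exists (fun t => invmx A *m t); split; last exact: mulmx_continuous.
    by move=> t; rewrite mulKmx.
  by move=> t; rewrite mulKVmx.
by split; [move=> s t; rewrite mulmxBr|exact: mulmx_continuous].
Qed.

(** The coordinates of [H t] are integers that are divisible by every positive
integer, because [t] is. *)
Lemma hom_to_torus0 (H : 'cV[R]_n -> 'cV[R]_n) : zmod_morphism H ->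
  (forall t, to_torus (H t) = 0) -> forall t, H t = 0.
Proof.
move=> HB HZ t; apply/matrixP => i j; rewrite ord1 [RHS]mxE.
pose H' : {additive 'cV[R]_n -> 'cV[R]_n} :=
  HB.pack H (GRing.isZmodMorphism.Build _ _ H HB).
have HMn m s : H (s *+ m) = H s *+ m := raddfMn H' m s.
apply/eqP; apply: contraT => Ht_neq0.
pose m := Num.Def.archi_bound `|H t i 0|.
have Htm := archi_boundP (normr_ge0 (H t i 0)).
have m_gt0 : (0 : R) < m%:R by apply: le_lt_trans Htm.
pose s := m%:R^-1 *: t.
have ts : H t i 0 = H s i 0 *+ m.
  rewrite -mulmxnE -HMn; congr (H _ i 0).
  by rewrite /s -scaler_nat scalerA divff ?scale1r ?gt_eqF.
have sZ : H s i 0 \is a Num.int by exact: (to_torus0P _).1 (HZ s) i.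
have s_neq0 : H s i 0 != 0.
  by apply: contraNneq Ht_neq0 => s0; rewrite ts s0 mul0rn.
move: Htm; rewrite -/m ts normrMn -[_ *+ m]mulr_natr gtr_pMl // ltNge.
by rewrite norm_intr_ge1.
Qed.

Lemma pi_hom_inj M (H K : 'cV[R]_n -> 'cV[R]_n) :
  zmod_morphism H -> zmod_morphism K ->
  (forall t, solenoid_pi M (H t) = solenoid_pi M (K t)) -> H =1 K.
Proof.
move=> HB KB HK t; apply/eqP; rewrite -subr_eq0; apply/eqP.
apply: (@hom_to_torus0 (fun t => H t - K t)) => [x y|x].
  by rewrite HB KB !opprB addrACA [RHS]addrACA; congr (_ + _); rewrite addrC.
have := congr1 (fun x : solenoid R M => val x 0%N) (HK x) => /= HKx.
by rewrite to_torusB HKx subrr.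
Qed.

Lemma pi_mulmx_inj M (A B : 'M[R]_n) :
  (forall t, solenoid_pi M (A *m t) = solenoid_pi M (B *m t)) -> A = B.
Proof.
move=> AB; have AB1 := @pi_hom_inj M (mulmx A) (mulmx B) (mulmxBr A) (mulmxBr B) AB.
by apply/matrixP => i j; have := AB1 (delta_mx j 0 : 'cV_n); rewrite -!colE;
  move=> /matrixP/(_ i 0); rewrite !mxE.
Qed.

Lemma solenoid_pi_line_continuous M j :
  continuous (fun s : R => solenoid_pi M (s *: (delta_mx j 0 : 'cV[R]_n))).
Proof.
apply: continuous_to_solenoid => k.
apply: continuous_to_mx => i i'.
rewrite (_ : (fun _ => _) =
    (fun s : R => to_circle (s * invmx (real (winding M k)) i j))); last first.
  apply/funext => s /=; rewrite mxE unwindE -scalemxAr mxE ord1.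
  by rewrite -colE mxE.
move=> s; apply: continuous_comp; last exact: to_circle_continuous.
by apply: cvgM; [exact: cvg_id|exact: cvg_cst].
Qed.

(** Along each coordinate axis each coordinate of a level is a character of the
real line. *)
Lemma level_lift M N (h : solenoid R M -> solenoid R N) k : top_hom h ->
  exists A, forall t, val (h (solenoid_pi M t)) k = to_torus (A *m t).
Proof.
move=> [hB h_cont].
pose f t := val (h (solenoid_pi M t)) k.
have fB : zmod_morphism f by move=> s t; rewrite /f raddfB hB.
pose f' : {additive 'cV[R]_n -> 'cV[circle R]_n} :=
  HB.pack f (GRing.isZmodMorphism.Build _ _ f fB).
have f_sum (t : 'I_n -> 'cV[R]_n) : f (\sum_i t i) = \sum_i f (t i) :=
  raddf_sum f' _ _ _.
have /choice[a aP] (ij : 'I_n * 'I_n) : exists a, forall s : R,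
    f (s *: delta_mx ij.2 0) ij.1 0 = to_circle (a * s).
  apply: continuous_character_linear.
    by move=> x y; rewrite scalerBl fB !mxE.
  move=> s; apply: (@continuous_comp R (solenoid R M) (circle R)
    (fun s => solenoid_pi M (s *: (delta_mx ij.2 0 : 'cV[R]_n)))
    (fun x => val (h x) k ij.1 0)).
    exact: solenoid_pi_line_continuous.
  apply: (@continuous_comp (solenoid R M) (solenoid R N) (circle R) h
    (fun x => val x k ij.1 0)); first exact: h_cont.
  apply: (@continuous_comp (solenoid R N) 'cV[circle R]_n (circle R)
    (fun x => val x k) (fun x => x ij.1 0)); first exact: level_continuous.
  exact: mx_entry_continuous.
exists (\matrix_(i, j) a (i, j)) => t; rewrite -/(f t).
have -> : t = \sum_j t j 0 *: (delta_mx j 0 : 'cV_n).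
  rewrite [LHS]matrix_sum_delta; apply: eq_bigr => j _.
  by rewrite big_ord1.
rewrite f_sum mulmx_sumr; apply/matrixP => i i'; rewrite ord1 mxE !summxE.
rewrite raddf_sum; apply: eq_bigr => j _.
by rewrite (aP (i, j)) /= -scalemxAr -colE !mxE mulrC.
Qed.

(** The matrices A_k obtained at the successive levels satisfy N_k A_(k+1) = A_k,
because a matrix is determined by the homomorphism to the torus that it defines.
They are therefore determined by A_0. *)
Lemma linear_lift M N (h : solenoid R M -> solenoid R N) : top_hom h ->
  exists A, forall t, h (solenoid_pi M t) = solenoid_pi N (A *m t).
Proof.
move=> h_hom; have /choice[A AP] := (fun k => level_lift k h_hom).
exists (A 0%N) => t; apply: val_inj; apply/funext => k; rewrite AP /= unwindE.
suff -> : A 0%N = real (winding N k) *m A k.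
  by rewrite !mulmxA mulVmx ?winding_unit // mul1mx.
elim: k => [|k ->]; first by rewrite /= /real_mx map_mx1 mul1mx.
rewrite /= real_mxM -mulmxA; congr (_ *m _).
apply/matrixP => i j; apply/eqP; rewrite -subr_eq0.
pose D := A k - real (N k) *m A k.+1.
have D0 : forall t : 'cV_n, D *m t = 0.
  apply: hom_to_torus0 => [|s]; first exact: mulmxBr.
  rewrite /D mulmxBl to_torusB -mulmxA -torus_map_to_torus.
  by rewrite -!AP; have /asboolP <- := valP (h (solenoid_pi M s)); rewrite subrr.
by have := D0 (delta_mx j 0); rewrite -colE => /matrixP/(_ i 0); rewrite !mxE => ->.
Qed.

Lemma level_arc_nbhs N k :
  nbhs (0 : solenoid R N)
    [set y : solenoid R N | forall i, small_arc 4^-1 (val y k i 0)].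
Proof.
suff nearP i : \forall y \near (0 : solenoid R N),
    small_arc 4^-1 (val (y : solenoid R N) k i 0).
  exact: (filter_forall (nbhs_filter (0 : solenoid R N)) nearP).
have e0 : (0 : R) < 4^-1 by rewrite invr_gt0.
have : {for (0 : solenoid R N), continuous (fun y : solenoid R N => val y k i 0)}.
  apply: (@continuous_comp (solenoid R N) 'cV[circle R]_n (circle R)
    (fun x => val x k) (fun x => x i 0)); first exact: level_continuous.
  exact: mx_entry_continuous.
have zk : val (0 : solenoid R N) k i 0 = 0 by rewrite mxE.
by move=> /(_ (small_arc 4^-1)); apply; rewrite /= zk; exact: small_arc_nbhs.
Qed.

Lemma continuous_compatible M N (h : solenoid R M -> solenoid R N) A :
  top_hom h -> (forall t, h (solenoid_pi M t) = solenoid_pi N (A *m t)) ->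
  compatible M N A.
Proof.
move=> [hB h_cont] hA; apply: compatible_of_near0 => k.
have h0 : h 0 = 0 by rewrite -(subrr 0) hB subrr.
exists (h @^-1` [set y : solenoid R N | forall i, small_arc 4^-1 (val y k i 0)]).
  by apply: h_cont; rewrite h0; exact: level_arc_nbhs.
by move=> t Wt i; rewrite -hA; exact: Wt.
Qed.

(** The homomorphisms induced by [A] and by its inverse compose to the map which
the identity matrix induces. *)
Lemma iso_of_compatible M A : A \in unitmx ->
  compatible M M A -> compatible M M (invmx A) ->
  exists2 h : solenoid R M -> solenoid R M, top_iso h &
    forall t, h (solenoid_pi M t) = solenoid_pi M (A *m t).
Proof.
move=> uA cA cA'.
have [h h_hom hP] := hom_of_compatible cA.
have [g g_hom gP] := hom_of_compatible cA'.
have comp_id A1 A2 (h1 h2 : solenoid R M -> solenoid R M) :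
    A1 *m A2 = 1%:M -> compatible M M A1 -> compatible M M A2 ->
    level_action A1 h1 -> level_action A2 h2 ->
    cancel h2 h1.
  move=> A12 c1 c2 h1P h2P x; apply: val_inj; apply/funext => k.
  have [l [B AB]] := c1 k; have [l' [B' AB']] := c2 l.
  rewrite (h1P _ _ _ AB) (h2P _ _ _ AB') -torus_map_mul.
  rewrite -[RHS]torus_map1; apply: levels_agree.
  have BB' : real (winding M k) *m real (B *m B') = real (winding M l').
    rewrite real_mxM mulmxA -AB -mulmxA -AB' mulmxA A12.
    exact: mul1mx.
  rewrite -[real (B *m B')](mulKmx (winding_unit R M k)) BB'.
  by rewrite mulmxK ?winding_unit // /real_mx map_mx1 mul1mx.
exists h; last exact: hom_levels_pi hP.
split=> //; exists g; split; last exact: g_hom.2.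
  by apply: (comp_id (invmx A) A) => //; rewrite mulVmx.
by apply: (comp_id A (invmx A)) => //; rewrite mulmxV.
Qed.

Lemma iso_lift M (h : solenoid R M -> solenoid R M) A :
  top_iso h -> (forall t, h (solenoid_pi M t) = solenoid_pi M (A *m t)) ->
  [/\ A \in unitmx, compatible M M A & compatible M M (invmx A)].
Proof.
move=> [h_hom [g [hg gh g_cont]]] hA.
have g_hom : top_hom g.
  split=> // x y; apply: (can_inj hg).
  by rewrite h_hom.1 !gh.
have [B gB] := linear_lift g_hom.
have AB : A *m B = 1%:M.
  by apply: (@pi_mulmx_inj M) => t; rewrite -mulmxA -hA -gB gh mul1mx.
have [uA _] := mulmx1_unit AB.
have -> : invmx A = B by rewrite -[RHS](mulKmx uA) AB mulmx1.
by split=> //; [exact: continuous_compatible h_hom hA|exact: continuous_compatible g_hom gB].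
Qed.

Lemma lift_ofE M (h : solenoid R M -> solenoid R M) A :
  A \in unitmx -> (forall t, h (solenoid_pi M t) = solenoid_pi M (A *m t)) ->
  matrix_of (lift_of h) = A.
Proof.
move=> uA hA.
have [] : [set H | top_iso H /\ h \o solenoid_pi M =1 solenoid_pi M \o H] (lift_of h).
  apply: xgetPex; exists (fun t => A *m t); split; first exact: mulmx_top_iso.
  by move=> t; rewrite /= hA.
move=> [[HB _] _] Hh.
have HA : lift_of h =1 mulmx A.
  apply: (@pi_hom_inj M) => // [|t]; first exact: mulmxBr.
  by rewrite -hA; exact/esym/Hh.
by apply/matrixP => i j; rewrite mxE HA -colE mxE.
Qed.

End Lifting.

(** * Properly arranged sequences have positive terms *)

(** The diagonals k + i = constant are run through one after the other: the
successor of the position of (k.+1, i) is that of (k, i.+1), and the successor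
of the end (0, i) of a diagonal is the beginning (i.+1, 0) of the next one. *)
Lemma pairing_surj j : exists k i, pairing k i = j.
Proof.
elim: j => [|j [[|k] [i <-]]]; first by exists 0%N, 0%N.
  exists i.+1, 0%N; rewrite /pairing addn0 add0n addn0.
  by rewrite -addn1; nia.
exists k, i.+1; rewrite /pairing addnS addSn; lia.
Qed.

Lemma nth_prime_gt0 k : (0 < nth_prime k)%N.
Proof.
case: k => [//|k]; rewrite /nth_prime /= /next_prime.
by case: ex_minnP => p /andP[_ /prime_gt0].
Qed.

Lemma arrange_gt0 n (P : 'I_n -> nzseq) k r J j i : (0 < arrange P k r J j i)%N.
Proof.
elim: r J => [//|r IH] J /=; case: pickP => [m _|_] //.
case: ifP => _ //; case: ifP => _ //; exact: nth_prime_gt0.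
Qed.

Lemma properly_arranged_gt0 n (P : 'I_n -> nzseq) : properly_arranged P ->
  forall i j, 0 < P i j.
Proof.
move=> arrP i j; have [k [l <-]] := pairing_surj j.
by rewrite arrP ltz_nat arrange_gt0.
Qed.

(** * Diagonal sequences and proper multipliers *)

Definition partial_prod (P : nzseq) l : int := \prod_(k < l) P k.

Lemma partial_prod_neq0 P l : partial_prod P l != 0.
Proof. by apply/prodf_neq0 => k _; case: P => p /=. Qed.

Lemma partial_prod_dvd P k l : (k <= l)%N ->
  exists c, partial_prod P l = partial_prod P k * c.
Proof.
move=> /subnKC <-; elim: (l - k)%N => [|d [c E]].
  by exists 1; rewrite addn0 mulr1.
exists (c * P (k + d)%N); rewrite addnS /partial_prod big_ord_recr /=.
by rewrite -/(partial_prod _ _) E mulrA.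
Qed.

Lemma winding_diag n (P : 'I_n -> nzseq) l :
  winding (diag_mxseq P) l = diag_mx (\row_i partial_prod (P i) l).
Proof.
elim: l => [|l IH] /=.
  by apply/matrixP => i j; rewrite !mxE /partial_prod big_ord0.
rewrite IH /diag_seq mulmx_diag; congr diag_mx; apply/rowP => i.
by rewrite !mxE /partial_prod big_ord_recr.
Qed.

Section Multipliers.
Variable R : realType.
Implicit Types (P Q : nzseq) (r s : R).

Definition scalar_compatible P Q r := forall k, exists l (b : int),
  r * (partial_prod P l)%:~R = (partial_prod Q k)%:~R * b%:~R.

(** Each entry comes with a level [l] of its own; the largest of these finitely
many levels serves for all of them, as the partial products divide one
another. *)
Lemma compatible_diagP n (P Q : 'I_n -> nzseq) (A : 'M[R]_n) :
  compatible (diag_mxseq P) (diag_mxseq Q) A <->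
  forall i j, scalar_compatible (P j) (Q i) (A i j).
Proof.
have entryE k l (B : 'M[int]_n) i j :
    (A *m real_mx R (winding (diag_mxseq P) l)) i j =
      A i j * (partial_prod (P j) l)%:~R /\
    (real_mx R (winding (diag_mxseq Q) k) *m real_mx R B) i j =
      (partial_prod (Q i) k)%:~R * (B i j)%:~R.
  by rewrite !winding_diag /real_mx !map_diag_mx mul_mx_diag mul_diag_mx !mxE.
split=> [cA i j k|cA k].
  have [l [B AB]] := cA k; exists l, (B i j).
  have /matrixP/(_ i j) := AB.
  by have [-> ->] := entryE k l B i j.
have /choice[l /choice[b lb]] (ij : 'I_n * 'I_n) := cA ij.1 ij.2 k.
pose L := \max_ij l ij.
have /choice[c cP] (ij : 'I_n * 'I_n) :
    exists c, partial_prod (P ij.2) L = partial_prod (P ij.2) (l ij) * c.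
  by apply: partial_prod_dvd; exact: leq_bigmax.
pose B := \matrix_(i, j) (b (i, j) * c (i, j)).
exists L, B; apply/matrixP => i j; have [-> ->] := entryE k L B i j.
by rewrite mxE (cP (i, j)) /= !rmorphM /= !mulrA (lb (i, j)).
Qed.

Lemma compatible_seqP P Q r :
  compatible (seq_mxseq P) (seq_mxseq Q) r%:M <-> scalar_compatible P Q r.
Proof.
rewrite compatible_diagP; split=> [/(_ 0 0)|c i j]; first by rewrite mxE.
by rewrite !ord1 mxE.
Qed.

Lemma scalar_mul_const r s : r%:M *m const_mx s = const_mx (r * s) :> 'cV[R]_1.
Proof. by rewrite mul_scalar_mx; apply/matrixP => i j; rewrite !mxE. Qed.

Lemma cV1_const (t : 'cV[R]_1) : t = const_mx (t 0 0).
Proof. by apply/matrixP => i j; rewrite !ord1 mxE. Qed.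

Lemma seq_winding_const P l s :
  real_mx R (winding (seq_mxseq P) l) *m const_mx s =
  const_mx ((partial_prod P l)%:~R * s) :> 'cV[R]_1.
Proof.
rewrite winding_diag /real_mx map_diag_mx mul_diag_mx.
by apply/matrixP => i j; rewrite !mxE.
Qed.

Lemma seq_pi_level0 P l s :
  val (seq_pi P s) l = 0 <-> exists b : int, s = (partial_prod P l)%:~R * b%:~R.
Proof.
pose t : 'cV[R]_1 := unwind (seq_mxseq P) (const_mx s) l.
have tE : real_mx R (winding (seq_mxseq P) l) *m t = const_mx s.
  by rewrite /t unwindE mulKVmx ?winding_unit.
have sE : s = (partial_prod P l)%:~R * t 0 0.
  by move: tE; rewrite (cV1_const t) seq_winding_const => /matrixP/(_ 0 0); rewrite !mxE.
have w0 : (partial_prod P l)%:~R != 0 :> R by rewrite intr_eq0 partial_prod_neq0.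
rewrite -[val _ l]/(to_torus t) to_torus0P; split=> [/(_ 0)/floorK tb|[b sb] i].
  by exists (Num.floor (t 0 0)); rewrite tb.
by rewrite ord1 -(mulfI w0 (etrans (esym sb) sE)) intr_int.
Qed.

Lemma eventually_one_prod P J : (forall j, (J <= j)%N -> P j = 1) ->
  \big[*%R/1]_(j \in [set: nat]) P j = partial_prod P J.
Proof.
move=> PJ; rewrite /partial_prod fsbig_ord; apply/esym/fsbig_widen => // j [_].
by rewrite /= => /negP; rewrite -leqNgt => /PJ.
Qed.

Lemma eventually_one_period P J : (forall j, (J <= j)%N -> P j = 1) ->
  component_pi P (partial_prod P J)%:~R = 0 :> component R P.
Proof.
move=> PJ; apply: val_inj; apply: val_inj; apply/funext => k.
apply: (solenoid_level0 (leq_maxr J k)); apply/seq_pi_level0; exists 1.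
rewrite mulr1 -!(eventually_one_prod (J := _)) // => j.
by rewrite geq_max => /andP[/PJ].
Qed.

(** When [P] is eventually 1, the half period p / 2 is in the domain on which the
multiplier is given by its formula, and it is mapped to an element of order
dividing 2.  So r p is mapped to 0 in the component of [Q].  When [P] is not
eventually 1, the formula holds for all parameters and the claim is the
one-dimensional case of [compatible_of_near0]. *)
Lemma proper_multiplier_compatible P Q r : (forall j, 0 < P j) ->
  proper_multiplier P Q r -> scalar_compatible P Q r.
Proof.
move=> P_gt0 [f fE [fB f_cont]].
have f0 : f 0 = 0 by rewrite -(subrr 0) fB subrr.
have [Pev|Pnev] := pselect (eventually_one P).
  case: (Pev) => J _ PJ'.
  have PJ j : (J <= j)%N -> P j = 1 by exact: PJ'.
  pose p : R := (partial_prod P J)%:~R.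
  have p_gt0 : 0 < p by rewrite ltr0z; apply: prodr_gt0.
  pose x : component R P := component_pi P (p / 2).
  have fx : f x = component_pi Q (r * (p / 2)).
    apply: fE; rewrite /param_domain asboolT // (eventually_one_prod PJ) -/p /=.
    by rewrite in_itv /=; apply/andP; split; lra.
  have xN : 0 - x = x.
    rewrite -(eventually_one_period PJ); apply: val_inj.
    rewrite /= -raddfB; congr (seq_pi P _); rewrite -/p; lra.
  have fxx : f x + f x = 0.
    by rewrite -[in X in X + _]xN fB f0 sub0r addNr.
  have rp0 : seq_pi Q (r * p) = 0.
    have := congr1 val fxx; rewrite fx /= -raddfD => <-.
    by congr (seq_pi Q _); lra.
  move=> k; exists J; apply/seq_pi_level0.
  by rewrite -/p rp0.
have {}fE s : f (component_pi P s) = component_pi Q (r * s).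
  by apply: fE; rewrite /param_domain asboolF.
apply/compatible_seqP; apply: compatible_of_near0 => k.
pose U := [set y : solenoid R (seq_mxseq Q) | forall i, small_arc 4^-1 (val y k i 0)].
have : nbhs (f 0) (val @^-1` U).
  rewrite f0.
  have := @initial_continuous (component R Q) (solenoid R (seq_mxseq Q))
    (fun x => val x) 0.
  by apply; exact: level_arc_nbhs.
move=> /f_cont[_ [[W oW <-] W0] WU].
exists W; first exact: open_nbhs_nbhs.
move=> t; rewrite (cV1_const t) => Wt.
have := WU (component_pi P (t 0 0)) Wt; rewrite /= fE => Ut i.
by have := Ut i; rewrite scalar_mul_const.
Qed.

(** The homomorphism of the whole solenoids restricts to the path components,
and it satisfies the formula for all parameters. *)
Lemma compatible_proper_multiplier P Q r :
  scalar_compatible P Q r -> proper_multiplier P Q r.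
Proof.
move=> /compatible_seqP c; have [h [hB h_cont] hP] := hom_of_compatible c.
have hE s : h (seq_pi P s) = seq_pi Q (r * s).
  by rewrite /seq_pi (hom_levels_pi c hP) scalar_mul_const.
have h_in (x : component R P) : component_pred (h (val x)).
  have /asboolP[s _ <-] := valP x; rewrite hE.
  exact: component_predT.
exists (fun x => exist _ (h (val x)) (h_in x)) => [s _|].
  by apply: val_inj; rewrite /= hE.
split=> [x y|]; first by apply: val_inj; rewrite /= hB.
apply: continuous_comp_initial => x.
apply: (@continuous_comp (component R P) (solenoid R (seq_mxseq P))
  (solenoid R (seq_mxseq Q)) val h); last exact: h_cont.
exact: initial_continuous.
Qed.

(** At level 0 the partial product of [Q] is empty, so that a nonzero integral
multiple of [r] is an integer. *)
Lemma scalar_compatible_rational P Q r : scalar_compatible P Q r ->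
  exists q : rat, r = ratr q.
Proof.
move=> /(_ 0%N)[l [b]]; rewrite {2}/partial_prod big_ord0 mul1r => rb.
exists (b%:~R / (partial_prod P l)%:~R).
rewrite fmorph_div !rmorph_int -rb mulfK // intr_eq0.
exact: partial_prod_neq0.
Qed.

Lemma compatible_rational_GL n (P : 'I_n -> nzseq) (A : 'M[R]_n) :
  A \in unitmx -> compatible (diag_mxseq P) (diag_mxseq P) A -> rational_GL A.
Proof.
move=> uA /compatible_diagP cA.
have /choice[q qP] (ij : 'I_n * 'I_n) := scalar_compatible_rational (cA ij.1 ij.2).
have AE : A = map_mx ratr (\matrix_(i, j) q (i, j)).
  by apply/matrixP => i j; rewrite !mxE -(qP (i, j)).
exists (\matrix_(i, j) q (i, j)) => //=.
by rewrite -(map_unitmx (@ratr R)) -AE.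
Qed.

End Multipliers.

(** * Automorphisms of a solenoid with diagonal bonding maps *)

Theorem theorem8 (R : realType) (n : nat) (P : 'I_n -> nzseq) :
  (0 < n)%N -> properly_arranged P ->
  let M := diag_mxseq P in
  let pi := @solenoid_pi R n M in
  [/\ (forall (h : solenoid R M -> solenoid R M) (H : 'cV[R]_n -> 'cV[R]_n)
         (A : 'M[R]_n),
         top_iso h -> top_iso H -> (forall t, h (pi t) = pi (H t)) ->
         (forall t, H t = A *m t) ->
         A \in unitmx /\
         (forall i j, proper_multiplier (P j) (P i) (A i j) /\
                      proper_multiplier (P j) (P i) (invmx A i j))),
      (forall A : 'M[R]_n, A \in unitmx ->
         (forall i j, proper_multiplier (P j) (P i) (A i j) /\
                      proper_multiplier (P j) (P i) (invmx A i j)) ->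
         exists2 h : solenoid R M -> solenoid R M,
           top_iso h & forall t, h (pi t) = pi (A *m t)) &
      [set matrix_of (lift_of h) | h in [set h : solenoid R M -> solenoid R M |
                                         top_iso h]]
      = [set A : 'M[R]_n | rational_GL A /\
           forall i j, proper_multiplier (P j) (P i) (A i j) /\
                       proper_multiplier (P j) (P i) (invmx A i j)]].
Proof.
move=> _ arrP M pi.
have P_gt0 := properly_arranged_gt0 arrP.
have entriesP (A : 'M[R]_n) : compatible M M A <->
    forall i j, proper_multiplier (P j) (P i) (A i j).
  rewrite compatible_diagP; split=> cA i j.
    exact/compatible_proper_multiplier/cA.
  exact/proper_multiplier_compatible/cA.
have iso_entries h A : top_iso h -> (forall t, h (pi t) = pi (A *m t)) ->
    A \in unitmx /\ forall i j, proper_multiplier (P j) (P i) (A i j) /\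
                                proper_multiplier (P j) (P i) (invmx A i j).
  move=> h_iso hA; have [uA cA cA'] := iso_lift h_iso hA.
  by split=> // i j; split; [exact: (entriesP _).1|exact: (entriesP _).1].
have iso_of_entries (A : 'M[R]_n) : A \in unitmx ->
    (forall i j, proper_multiplier (P j) (P i) (A i j) /\
                 proper_multiplier (P j) (P i) (invmx A i j)) ->
    exists2 h : solenoid R M -> solenoid R M,
      top_iso h & forall t, h (pi t) = pi (A *m t).
  move=> uA multA; apply: iso_of_compatible => //;
    by apply/entriesP => i j; have [] := multA i j.
split=> [h H A h_iso _ hH HA||].
- by apply: iso_entries h_iso _ => t; rewrite hH HA.
- exact: iso_of_entries.
- apply/seteqP; split=> [_ [h /= h_iso <-]|A [[B uB BA] multA]].
    have [A hA] := linear_lift h_iso.1.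
    have [uA cA _] := iso_lift h_iso hA.
    rewrite (lift_ofE uA hA); split; last exact: (iso_entries h A h_iso hA).2.
    exact: compatible_rational_GL cA.
  have uA : A \in unitmx by rewrite -BA map_unitmx.
  have [h h_iso hA] := iso_of_entries A uA multA.
  by exists h => //; exact: lift_ofE.
Qed.
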